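(* For a locally compact abelian group $X$ the following are equivalent: (i) $X\in\mathfrak B$. (ii) $X$ is locally generated. (iii) $X$ is connected.
   Context: Locally compact abelian groups are understood to be Hausdorff, as usual. $\mathbb S=\{s\in\mathbb C:|s|=1\}$. For a topological abelian group $X$, $X^\wedge$ is the group of all continuous homomorphisms $X\to\mathbb S$, with neutral element $1$ (the constant character), and $c_0(X)$ is the group of all sequences in $X$ converging to the neutral element. $\Gamma_{\mathrm{abs}}(X)$ is the set of $\xi\in X^\wedge$ such that for every $(x_n)\in c_0(X)$ the sequence of partial products $\left(\prod_{k=1}^n\xi(x_k)\right)_{n\in\mathbb N}$ converges in $\mathbb S$. $\mathfrak B$ is the class of topological abelian groups $X$ with $\Gamma_{\mathrm{abs}}(X)=\{1\}$. A topological group $X$ is locally generated if every neighborhood $V$ of the neutral element generates $X$ as a group, i.e. $\langle V\rangle=X$. *)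

(* Defs.v *)
From HB Require Import structures.
From mathcomp Require Import all_boot all_order all_algebra.
From mathcomp Require Import complex.
From mathcomp Require Import all_classical all_reals all_analysis.

Set Implicit Arguments.
Unset Strict Implicit.
Unset Printing Implicit Defensive.

Import Order.TTheory GRing.Theory Num.Theory.
Import numFieldNormedType.Exports.

Local Open Scope classical_set_scope.
Local Open Scope ring_scope.
Local Open Scope complex_scope.

(* Topological abelian groups are written additively; complex numbers are
   R[i]^o, the alias of R[i] that carries the topology of the modulus. *)

Definition circle (R : realType) : set R[i]^o := [set z | `|z| = 1].

(* Characters are represented as complex-valued functions with values in the
   circle; since the circle has the subspace topology, continuity into the
   circle is continuity into R[i]^o. *)
Definition dual (R : realType) (X : topologicalZmodType) :
    set (X -> R[i]^o) :=
  [set xi | [/\ forall x, circle (xi x),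
                forall x y, xi (x + y) = xi x * xi y
              & continuous xi]].
Arguments dual : clear implicits.

Definition c0 (X : topologicalZmodType) : set (nat -> X) :=
  [set x | x n @[n --> \oo] --> (0 : X)].
Arguments c0 : clear implicits.

(* Sequences start at index 0, so the product of the first n terms is over
   k < n. *)
Definition Gamma_abs (R : realType) (X : topologicalZmodType) :
    set (X -> R[i]^o) :=
  [set xi | dual R X xi /\
     forall x : nat -> X, c0 X x ->
       exists2 l : R[i]^o, circle l &
         \prod_(k < n) xi (x k) @[n --> \oo] --> l].
Arguments Gamma_abs : clear implicits.

Definition class_B (R : realType) (X : topologicalZmodType) : Prop :=
  Gamma_abs R X = [set cst 1].

Definition generated_subgroup (X : zmodType) (V : set X) : set X :=
  smallest [set A : set X | zmod_closed [in A]] V.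

Definition locally_generated (X : topologicalZmodType) : Prop :=
  forall V : set X, nbhs 0 V -> generated_subgroup V = [set: X].

(* Main.v *)
Require Import Defs.
From mathcomp Require Import all_boot all_order all_algebra.
From mathcomp Require Import complex ring.
From mathcomp Require Import all_classical all_reals all_analysis.

(* If [X] is not locally generated, it has a proper open subgroup [H]; the
   circle being divisible, some nontrivial character is trivial on [H], and
   every null sequence is eventually in [H].

   If [X] is disconnected, let [Q] be the quasi-component of 0. Clopen sets are
   [Q]-invariant, so a clopen neighborhood of 0 that stays close to [Q] is the
   sum of a compact set and [Q], hence stable under adding some neighborhood
   [V] of 0, and thus contains the subgroup generated by [V].

   If [X] is connected and [xi] is a nontrivial character, the kernel of [xi] is
   not open. As [X] need not be first countable, one obtains only a sequence off
   the kernel converging to 0 modulo a compact subgroup of the kernel; by Zorn's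
   lemma, shrinking this subgroup by metrizable steps, it can be corrected to
   converge to 0. Repeating its terms often enough then makes the partial
   products diverge, since the circle has no small subgroups. *)

Set Implicit Arguments.
Unset Strict Implicit.
Unset Printing Implicit Defensive.

Import Order.TTheory GRing.Theory Num.Theory.
Import numFieldNormedType.Exports.

Local Open Scope classical_set_scope.
Local Open Scope ring_scope.

(** * Topological groups *)

(** The traces of the [F i] on [K] form a proper filter base; its cluster point in [K] lies in every
    [F i] because these are closed. *)
Lemma compact_directed (T : topologicalType) (I : Type) (D : set I)
    (F : I -> set T) (K : set T) :
  compact K -> D !=set0 ->
  (forall i j, D i -> D j -> exists2 k, D k & F k `<=` F i `&` F j) ->
  (forall i, D i -> closed (F i)) ->
  (forall i, D i -> K `&` F i !=set0) ->
  K `&` \bigcap_(i in D) F i !=set0.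
Proof.
move=> cK D0 dirF clF KF.
have FF : ProperFilter (filter_from D (fun i => K `&` F i)).
  apply: filter_from_proper => //; apply: filter_from_filter => //.
  move=> i j Di Dj; have [k Dk kij] := dirF i j Di Dj.
  by exists k => // x [Kx /kij[]].
have [|x [Kx clx]] := cK _ FF; first by have [i Di] := D0; exists i => // x [].
exists x; split=> // i Di; apply: clF => // B /(clx (K `&` F i)).
by case=> [|y [[_ Fy] By]]; [exists i | exists y].
Qed.

Definition subgroup (X : zmodType) (N : set X) :=
  N 0 /\ forall a b, N a -> N b -> N (a - b).

Lemma subgroupN (X : zmodType) (N : set X) a : subgroup N -> N a -> N (- a).
Proof. by case=> N0 NB Na; rewrite -sub0r; exact: NB. Qed.

Lemma subgroupD (X : zmodType) (N : set X) a b :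
  subgroup N -> N a -> N b -> N (a + b).
Proof.
move=> sN Na Nb; rewrite -[b]opprK; apply: (proj2 sN) => //; exact: subgroupN.
Qed.

Section TopologicalGroup.
Variable X : topologicalZmodType.
Implicit Types (U V W N O K : set X) (x y : nat -> X) (a b : X).

Lemma nbhs_subr U a : nbhs 0 U -> nbhs a [set t | U (t - a)].
Proof.
move=> nU; have /(_ U) : (fun t => t - a) @ a --> (0 : X); last exact.
rewrite -[X in _ --> X](subrr a).
apply: (@continuous_comp _ _ _ (fun t => (t, - a)) (fun z : X * X => z.1 + z.2)).
  by apply: cvg_pair; [exact: cvg_id | exact: cvg_cst].
exact: add_continuous.
Qed.

Lemma nbhs_addr U a : nbhs a U -> nbhs 0 [set t | U (t + a)].
Proof.
move=> nU; have /(_ U) : (fun t => t + a) @ (0 : X) --> a; last exact.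
rewrite -[X in _ --> X]add0r.
apply: (@continuous_comp _ _ _ (fun t => (t, a)) (fun z : X * X => z.1 + z.2)).
  by apply: cvg_pair; [exact: cvg_id | exact: cvg_cst].
exact: add_continuous.
Qed.

Lemma nbhs_oppr U a : nbhs a U -> nbhs (- a) [set t | U (- t)].
Proof.
move=> nU; have := @opp_continuous X (- a); rewrite /continuous_at opprK.
exact.
Qed.

Lemma closed_subr U a : closed U -> closed [set t | U (t - a)].
Proof.
move=> cU t clt; apply: cU => B nB.
have [|s [Us Bs]] := clt [set s | B (s - a)].
  have /nbhs_addr nB' := nB; have := nbhs_subr t nB'.
  by apply: filterS => s /=; rewrite addrA subrK.
by exists (s - a).
Qed.

Lemma open_subr U a : open U -> open [set t | U (t - a)].
Proof.
rewrite -(setCK U) openC => /(@closed_subr _ a).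
by rewrite -openC.
Qed.

Lemma nbhs0_add U : nbhs 0 U ->
  exists2 V, nbhs 0 V & forall a b, V a -> V b -> U (a + b).
Proof.
move=> nU; have := @add_continuous X (0, 0); rewrite /continuous_at /= addr0.
move=> /(_ _ nU) [[V1 V2] /= [nV1 nV2] V12].
exists (V1 `&` V2); first exact: filterI.
by move=> a b [Va _] [_ Vb]; exact: (V12 (a, b)).
Qed.

(** Closedness and symmetry are what make the intersection of an iterated sequence of such sets a
    closed subgroup. *)
Definition small_half U V := [/\ nbhs 0 V, closed V,
  forall a, V a -> V (- a) & forall a b, V a -> V b -> U (a + b)].

(** Halving twice leaves room for the closure: a point of [closure V] differs from some point of [V]
    by an element of [V], so it lies in [V + V], inside [U1]. *)
Lemma nbhs0_half U : nbhs 0 U -> exists V, small_half U V.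
Proof.
move=> /nbhs0_add[U1 /nbhs0_add[U2 nU2 U12] U01].
pose V := U2 `&` [set t | U2 (- t)].
have nV : nbhs 0 V.
  by apply: filterI => //; rewrite -[0]oppr0; exact: nbhs_oppr.
have VN a : V a -> V (- a) by move=> [? ?]; split => //=; rewrite opprK.
have clV a : closure V a -> U1 a.
  move=> /(_ [set t | V (t - a)]) [|b [Vb Vba]]; first exact: nbhs_subr.
  rewrite -[a](subrK b) addrC; apply: U12; first by case: Vb.
  by case: (VN _ Vba); rewrite opprB.
exists (closure V); split.
- by apply: filterS nV; exact: subset_closure.
- exact: closed_closure.
- move=> a cla B /nbhs_oppr; rewrite opprK => /cla[b [Vb Bb]].
  by exists (- b); split => //; exact: VN.
- by move=> a b /clV ? /clV ?; exact: U01.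
Qed.

Lemma nbhs0_seq U : nbhs 0 U ->
  exists2 V : nat -> set X, small_half U (V 0)
    & forall k, small_half (V k) (V k.+1).
Proof.
move=> nU; have [V0 hV0] := nbhs0_half nU.
pose T := {V : set X | nbhs 0 V}.
have nxt (V : T) : {W : T | small_half (sval V) (sval W)}.
  apply: cid; have [W hW] := nbhs0_half (svalP V).
  by have [nW _ _ _] := hW; exists (exist _ W nW).
have nV0 : nbhs 0 V0 by case: hV0.
pose f := fix f k : T := if k is k'.+1 then sval (nxt (f k')) else exist _ V0 nV0.
exists (fun k => sval (f k)) => // k.
exact: svalP (nxt (f k)).
Qed.

Lemma small_half_sub U V : small_half U V -> V `<=` U.
Proof.
case=> nV _ _ VU a Va; rewrite -[a]addr0; apply: VU => //.
exact: nbhs_singleton.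
Qed.

(** * Null sequences modulo a compact subgroup *)

(* [x] converges to 0 in the quotient by [N]. *)
Definition null_mod N x := forall O, nbhs 0 O ->
  \forall n \near \oo, exists2 a, N a & O (x n - a).

(** Otherwise every [F i] contains points of [K] that are not [O]-close to the intersection [M]. By
    compactness these accumulate at a point of [M], to which some of them are then [O]-close. *)
Lemma bigcap_thickening (I : Type) (D : set I) (F : I -> set X) K O :
  compact K -> D !=set0 ->
  (forall i j, D i -> D j -> exists2 k, D k & F k `<=` F i `&` F j) ->
  (forall i, D i -> closed (F i)) -> nbhs 0 O ->
  exists2 i, D i & forall a, K a -> F i a ->
    exists2 b, (K `&` \bigcap_(i in D) F i) b & O (a - b).
Proof.
move=> cK D0 dF cF nO; apply: contrapT => noi.
pose M := K `&` \bigcap_(i in D) F i.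
pose G := [set a | ~ exists2 b, M b & O (a - b)].
pose C := closure G.
have [a [[Ka Ca] Fa]] : (K `&` C) `&` \bigcap_(i in D) F i !=set0.
  apply: compact_directed => //.
    by apply: compact_closedI => //; exact: closed_closure.
  move=> i Di; apply: contrapT => no; apply: noi; exists i => // a Ka Fa.
  apply: contrapT => nex; apply: no; exists a; split => //.
  by split => //; apply: subset_closure.
have [|b [+ Ob]] := Ca [set b | O (b - a)]; first exact: nbhs_subr.
by apply; exists a.
Qed.

Section SmallSequence.
Variable V : nat -> set X.
Hypothesis hV : forall k, small_half (V k) (V k.+1).
Hypothesis cV : forall k, closed (V k).

Lemma small_seq_sub k l : (k <= l)%N -> V l `<=` V k.
Proof.
move=> /subnK <-; elim: (l - k)%N => [|m IH] // a; rewrite addSn.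
by move/(small_half_sub (hV _)); exact: IH.
Qed.

Lemma small_seq_nbhs k : nbhs 0 (V k).
Proof.
have [nV _ _ _] := hV k.
by apply: filterS nV; exact: small_half_sub.
Qed.

Lemma small_seq_subr k a b : V k.+1 a -> V k.+1 b -> V k (a - b).
Proof. by case: (hV k) => _ _ VN VD Va Vb; apply: VD => //; exact: VN. Qed.

Lemma small_seq_bigcap_subgroup N : subgroup N ->
  subgroup (N `&` \bigcap_k V k).
Proof.
move=> [N0 NB]; split.
  by split=> // k _; exact: nbhs_singleton (small_seq_nbhs k).
move=> a b [Na Va] [Nb Vb]; split; first exact: NB.
by move=> k _; apply: small_seq_subr; [exact: Va | exact: Vb].
Qed.

Lemma small_seq_thickening K O : compact K -> nbhs 0 O ->
  exists k, forall a, K a -> V k a ->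
    exists2 b, (K `&` \bigcap_k V k) b & O (a - b).
Proof.
move=> cK nO.
have [|i j _ _|k _|k _ hk] := @bigcap_thickening nat setT V K O cK _ _ _ nO.
- by exists 0%N.
- exists (maxn i j) => // a Va.
  by split; apply: small_seq_sub Va; rewrite ?leq_maxl ?leq_maxr.
- exact: cV.
- by exists k.
Qed.

End SmallSequence.

(* When [N] is nontrivial, [U] can be chosen so that [N'] is strictly smaller. *)
Lemma refine_null_mod N x U :
  compact N -> subgroup N -> null_mod N x -> nbhs 0 U ->
  exists N' y, [/\ compact N', subgroup N', N' `<=` N `&` U, null_mod N' y
    & forall n, N (y n - x n)].
Proof.
move=> cN sN xN nU; have [V hV0 hV] := nbhs0_seq nU.
have cV k : closed (V k) by case: k => [|k]; [case: hV0 | case: (hV k)].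
(* Modulo [N], [x n] is moved into the smallest [V k] with [k < n] that it can reach. The cap at [n]
   makes this a finite search; the induction runs on the cap alone. *)
have /choice[y yP] n : exists b, N (b - x n) /\
    forall k, (k < n)%N -> (exists2 a, N a & V k (x n - a)) -> V k b.
  elim: {2}n => [|m [b [Nb bP]]]; first by exists (x n); rewrite subrr; case: sN.
  have [[a Na Va]|noa] := pselect (exists2 a, N a & V m (x n - a)).
    exists (x n - a); split.
      by rewrite addrAC subrr sub0r; exact: subgroupN.
    by move=> k; rewrite ltnS => km _; exact: (small_seq_sub hV km).
  exists b; split=> // k; rewrite ltnS leq_eqVlt => /predU1P[->|]; first by [].
  exact: bP.
exists (N `&` \bigcap_k V k), y; split.
- apply: compact_closedI => //; apply: closed_bigI => k _; exact: cV.
- exact: small_seq_bigcap_subgroup.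
- move=> a [Na Va]; split=> //; exact: (small_half_sub hV0 (Va 0 I)).
- move=> O /nbhs0_half[ O' [nO' _ _ O'D]].
  have [j hj] := small_seq_thickening hV cV cN nO'.
  have nOV : nbhs 0 (O' `&` V j.+1).
    by apply: filterI => //; exact: small_seq_nbhs.
  near=> n.
  have [a Na [ O'a Va]] : exists2 a, N a & (O' `&` V j.+1) (x n - a).
    by near: n; exact: xN.
  have [Nyx yV] := yP n.
  have Vy : V j.+1 (y n).
    apply: yV; last by exists a.
    by near: n; exact: nbhs_infty_gt.
  (* Both [y n] and [x n - a] lie in [V j.+1], so their difference is an element of [N] in [V j],
     hence close to the new subgroup. *)
  have [||b N'b O'b] := hj (y n - (x n - a)).
  + by rewrite opprB addrCA addrC; apply: subgroupD.
  + exact: small_seq_subr.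
  exists b => //; rewrite (_ : _ - _ = (x n - a) + (y n - (x n - a) - b)).
    exact: O'D.
  by rewrite [RHS]addrA [x n - a + _]addrC subrK.
- by move=> n; case: (yP n).
Unshelve. all: by end_near.
Qed.

Lemma lift_null N x : hausdorff_space X ->
  compact N -> subgroup N -> null_mod N x ->
  exists2 y, (forall n, N (y n - x n)) & y n @[n --> \oo] --> (0 : X).
Proof.
move=> hX cN sN xN.
pose P (p : set X * (nat -> X)) := [/\ compact p.1, subgroup p.1, p.1 `<=` N,
  null_mod p.1 p.2 & forall n, N (p.2 n - x n)].
pose T := {p | P p}.
(* A later pair has a smaller subgroup and alters the sequence only by elements of the earlier
   subgroup. *)
pose R (s t : T) := `[< (sval t).1 `<=` (sval s).1 /\
  forall n, (sval s).1 ((sval t).2 n - (sval s).2 n) >].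
have PN : P (N, x) by split=> //= n; rewrite subrr; case: sN.
have Rtrans : forall r s t, R r s -> R s t -> R r t.
  move=> r s t; have [_ sr _ _ _] := svalP r.
  move=> /asboolP[/= sr1 sr2] /asboolP[st1 st2]; apply/asboolP.
  split=> [a /st1 /sr1 //|n /=].
  rewrite -(subrK ((sval s).2 n) ((sval t).2 n)) -addrA.
  by apply: subgroupD => //; exact: sr1.
have Rxx t : R t t.
  apply/asboolP; split=> // n; rewrite subrr.
  by have [_ []] := svalP t.
have [|[[N' y] /= [cN' sN' N'N yN' yx]] maxN'] :=
    @ZL_preorder T (exist _ _ PN) R Rxx Rtrans.
  move=> A totA.
  have [[t0 At0]|A0] := pselect (A !=set0); last first.
    by exists (exist _ _ PN) => s As; exfalso; apply: A0; exists s.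
  have dirA s t : A s -> A t -> exists2 u, A u & R s u /\ R t u.
    move=> As At; have [st|ts] := totA s t As At.
      by exists t.
    by exists s.
  have clA (s : T) : closed (sval s).1.
    by have [cs _ _ _ _] := svalP s; exact: compact_closed.
  pose M := N `&` \bigcap_(s in A) (sval s).1.
  (* The cosets of the subgroups in the chain through the [n]-th terms of their sequences are
     nested. Shifted by [- x n] they are closed and meet the compact [N], so they have a common
     point. *)
  have /choice[y yP] n : exists b, N (b - x n) /\
      forall s, A s -> (sval s).1 (b - (sval s).2 n).
    have [|s t As At|s As|s As|z [Nz zA]] := @compact_directed X T A
        (fun s => [set t | (sval s).1 (t - ((sval s).2 n - x n))]) N cN.
    + by exists t0.
    + have [u Au [/asboolP[su1 su2] /asboolP[tu1 tu2]]] := dirA _ _ As At.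
      have sub (r : T) z : (sval u).1 `<=` (sval r).1 ->
          (sval r).1 ((sval u).2 n - (sval r).2 n) ->
          (sval u).1 (z - ((sval u).2 n - x n)) ->
          (sval r).1 (z - ((sval r).2 n - x n)).
        move=> ur hr /ur hz; have [_ sr _ _ _] := svalP r.
        have := subgroupD sr hz hr; congr ((sval r).1 _).
        by rewrite !opprB -addrA; congr (z + _); rewrite addrA subrK.
      by exists u => // z /= hz; split; exact: sub hz.
    + exact: closed_subr.
    + exists ((sval s).2 n - x n); have [_ [s0 _] _ _ hs] := svalP s.
      by split=> //=; rewrite subrr.
    + exists (z + x n); rewrite addrK; split=> // s As.
      by have := zA s As; rewrite /= opprB addrA.
  have PM : P (M, y).
    split=> /=.
    + by apply: compact_closedI => //; apply: closed_bigI => s _; exact: clA.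
    + split; first by split=> [|s _]; [case: sN | have [_ []] := svalP s].
      move=> a b [Na Aa] [Nb Ab]; split=> [|s As]; first by case: sN => _; exact.
      by have [_ [_ sB] _ _ _] := svalP s; apply: sB; [exact: Aa | exact: Ab].
    + by move=> a [].
    (* One subgroup of the chain is already [O']-close to [M], and the limit sequence differs from
       its sequence by elements of that subgroup. *)
    + move=> O /nbhs0_half[ O' [nO' _ _ O'D]].
      have [|s t As At|s As|s As hs] := @bigcap_thickening T A
        (fun s => (sval s).1) N O' cN _ _ _ nO'.
      * by exists t0.
      * have [u Au [/asboolP[su1 _] /asboolP[tu1 _]]] := dirA _ _ As At.
        by exists u => // a ua; split; [exact: su1 | exact: tu1].
      * exact: clA.
      have [_ ss sN' nul _] := svalP s.
      near=> n.
      have [a sa O'a] : exists2 a, (sval s).1 a & O' ((sval s).2 n - a).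
        by near: n; exact: nul.
      have sya : (sval s).1 (y n - (sval s).2 n + a).
        by apply: subgroupD => //; case: (yP n) => _ /(_ _ As).
      have [|//|b Mb O'b] := hs (y n - (sval s).2 n + a); first exact: sN'.
      exists b => //; have := O'D _ _ O'a O'b; congr O.
      rewrite addrA; congr (_ - b).
        by rewrite -[y n - _ + a]addrA [- _ + a]addrC -[a - _]opprB addrC subrK.
    + by move=> n; case: (yP n).
  exists (exist _ _ PM) => s As; apply/asboolP; split=> /= [a [_]|n]; first exact.
  by case: (yP n) => _; exact.
exists y => // O /yN' hO.
suff: \forall n \near \oo, O (y n) by [].
near=> n.
have [a N'a] : exists2 a, N' a & O (y n - a) by near: n; exact: hO.
(* A nonzero [a] in the minimal subgroup could be removed by refining inside the complement of [a],
   against maximality of the pair. *)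
suff -> : a = 0 by rewrite subr0.
apply: contrapT => a0.
have nU : nbhs 0 (~` [set a]).
  apply: open_nbhs_nbhs; split; last by move=> /esym.
  apply: closed_openC; apply: accessible_closed_set1.
  exact: hausdorff_accessible.
have [N'' [z [cN'' sN'' N''sub zN'' zy]]] := refine_null_mod cN' sN' yN' nU.
have PN'' : P (N'', z).
  split=> //= [b /N''sub[/N'N]//|m].
  by rewrite -(subrK (y m) (z m)) -addrA; apply: subgroupD => //; apply/N'N.
have /asboolP[/= N'N'' _] : R (exist _ _ PN'')
    (exist _ (N', y) (And5 cN' sN' N'N yN' yx)).
  apply: maxN'; apply/asboolP; split=> //= b /N''sub[]//.
by have [_] := N''sub _ (N'N'' _ N'a); apply.
Unshelve. all: by end_near.
Qed.

(** * Local generation implies connectedness *)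

Lemma compact_nbhs0 : locally_compact [set: X] ->
  exists2 K : set X, nbhs 0 K & compact K /\ closed K.
Proof.
move=> lcX; have [K nK cK] := lcX 0 I; exists K => //.
have : nbhs (0 : X) [set a | [set: X] a -> K a] by [].
by apply: filterS => a /(_ I).
Qed.

Lemma locally_generated_connected :
  locally_compact [set: X] -> locally_generated X -> connected [set: X].
Proof.
move=> lcX lg B [b0 Bb0] [C oC BC] [C' cC' BC'].
rewrite setTI in BC; rewrite setTI in BC'.
have oB : open B by rewrite BC.
have cB : closed B by rewrite BC'.
clear C C' BC BC' oC cC'.
pose clop W := open W /\ closed W.
pose Q := [set a | forall W, clop W -> W 0 -> W a].
(* The translate of [W] by [- a] is a clopen set containing 0, so it contains [Q]. *)
have clopQ W a b : clop W -> W a -> Q b -> W (a + b).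
  move=> [oW cW] Wa Qb.
  have : [set t | W (t - - a)] b; last by rewrite /= opprK addrC.
  apply: Qb; last by rewrite /= opprK add0r.
  by split; [exact: open_subr | exact: closed_subr].
have clopQN W a b : clop W -> W (a + b) -> Q b -> W a.
  move=> [oW cW] Wab Qb; apply: contrapT => Wa.
  suff : (~` W) (a + b) by [].
  apply: clopQ => //; split; [exact: closed_openC | exact: open_closedC].
have QD a b : Q a -> Q b -> Q (a + b).
  by move=> Qa Qb W cW W0; apply: clopQ => //; exact: Qa.
pose U := [set t | B (t + b0)].
have cU : clop U.
  rewrite /U -[b0]opprK.
  by split; [exact: open_subr | exact: closed_subr].
have U0 : U 0 by rewrite /U /= add0r.
have [K nK [cK clK]] := compact_nbhs0 lcX.
pose O := [set t | exists2 q, Q q & K^° (t - q)].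
have oO : open O.
  rewrite openE => t [q Qq Kq].
  have : nbhs t [set s | K^° (s - q)].
    by apply: open_nbhs_nbhs; split => //; apply: open_subr; exact: open_interior.
  by apply: filterS => s Ks; exists q.
have OQ a b : O a -> Q b -> O (a + b).
  move=> [q Qq Kq] Qb; exists (q + b); first exact: QD.
  by rewrite opprD addrACA subrr addr0.
have Q0 : Q 0 by [].
have KO a : K^° a -> O a by move=> Ka; exists 0; rewrite ?subr0.
(* The part of [K] outside [O] is compact and misses [Q], the intersection of all clopen
   neighborhoods of 0, so a single one of them already misses it. *)
have [W [[cW W0 WU] WO]] : exists W, [/\ clop W, W 0 & W `<=` U] /\
    forall a, K a -> W a -> O a.
  apply: contrapT => noW.
  have [||W W' [[oW cW] W0 WU] [[oW' cW'] W'0 _]|W [[_ ]]//|W [cW W0 WU]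
    |a [[Ka nOa] Qa]] := @compact_directed X (set X)
      [set W | [/\ clop W, W 0 & W `<=` U]] id (K `&` ~` O).
  - by apply: compact_closedI => //; exact: open_closedC.
  - by exists U; split.
  - exists (W `&` W') => //; split=> //; last by move=> a [/WU].
    by split; [exact: openI | exact: closedI].
  - apply: contrapT => no; apply: noW; exists W; split=> // a Ka Wa.
    by apply: contrapT => nOa; apply: no; exists a.
  apply: nOa; rewrite -[a]add0r; apply: OQ.
    by apply: KO; exact: nbhs_singleton (nbhs_interior nK).
  move=> W [oW cW] W0; have [oU clU] := cU.
  suff [] : (W `&` U) a by [].
  by apply: Qa; split=> //; split; [exact: openI | exact: closedI].
(* Tube lemma: the compact set [K] intersected with [W] lies in the open set [W] intersected with
   [O], which leaves a uniform margin [V]. *)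
have [V [nV VN WV]] : exists V, [/\ nbhs 0 V, forall a, V a -> V (- a)
    & forall a v, K a -> W a -> V v -> (W `&` O) (a + v)].
  have cKW : compact (K `&` W) by apply: compact_closedI => //; case: cW.
  have nKW a : (K `&` W) a ->
      \forall a' \near a & v \near nbhs 0, (W `&` O) (a' + v).
    move=> [Ka Wa]; have : nbhs (a + 0) (W `&` O).
      rewrite addr0; apply: open_nbhs_nbhs; split; last by split => //; exact: WO.
      by apply: openI => //; case: cW.
    by move=> /(@add_continuous X (a, 0)).
  have nV := (compact_near_coveringP _).1 cKW X (nbhs 0)
    (fun v a => (W `&` O) (a + v)) (nbhs_filter 0) nKW.
  exists [set v | forall a, K a -> W a ->
    (W `&` O) (a + v) /\ (W `&` O) (a - v)]; split.
  - have := nbhs_oppr nV; rewrite oppr0 => /(filterI nV).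
    by apply: filterS => v [hv hNv] a Ka Wa; split; [exact: hv | exact: hNv].
  - by move=> v /= hv a Ka Wa; rewrite opprK; case: (hv a).
  - by move=> a v Ka Wa hv; case: (hv a Ka Wa).
(* Subtracting a suitable [q] in [Q] brings [a] into [K] without leaving [W]; there [V] may be
   added, and adding [q] back is harmless. *)
have WOV a v : (W `&` O) a -> V v -> (W `&` O) (a + v).
  move=> [Wa [q Qq /interior_subset Ka]] Vv.
  have Waq : W (a - q) by apply: (clopQN _ _ _ cW _ Qq); rewrite subrK.
  have [Wv Ov] := WV _ _ Ka Waq Vv.
  rewrite -(subrK q a) -addrA (addrC q) addrA; split; first exact: clopQ.
  exact: OQ.
(* Asking for both [a + t] and [a - t] makes this set of translations a subgroup. *)
have : generated_subgroup V `<=` [set t | forall a, (W `&` O) a ->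
    (W `&` O) (a + t) /\ (W `&` O) (a - t)].
  apply: smallest_sub.
    split.
      by rewrite inE /= => a; rewrite subr0 addr0.
    move=> s t; rewrite !inE /= => hs ht a WOa.
    split; rewrite ?opprB addrA.
      by case: (hs _ WOa) => /ht[].
    by case: (ht _ WOa) => /hs[].
  by move=> v Vv a WOa; split; apply: WOV => //; exact: VN.
rewrite lg // => gen; apply/seteqP; split => // t _.
have [|+ _] := gen (t - b0) I 0.
  split=> //; apply: KO; exact: nbhs_singleton (nbhs_interior nK).
by move=> [/WU]; rewrite /U /= add0r subrK.
Qed.

End TopologicalGroup.

(** * Connected groups *)

Section Circle.
Variable R : realType.
Local Notation C := (R[i]^o).

(* Squaring expands the distance to 1 by a factor 3/2 as long as it is at most
   1/2. *)
Lemma circle_power_far (z : C) : z != 1 ->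
  exists m : nat, 2^-1 < `|z ^+ m - 1|.
Proof.
move=> z1; apply: contrapT => noz.
have le_half m : `|z ^+ m - 1| <= 2^-1.
  rewrite real_leNgt ?normr_real ?ger0_real ?invr_ge0 ?ler0n //.
  by apply/negP => zm; apply: noz; exists m.
(* The factor is Bernoulli's lower bound for the [k]-th power of 3/2; linear growth is enough. *)
have grow k : (1 + k%:R / 2) * `|z - 1| <= `|z ^+ (2 ^ k) - 1|.
  elim: k => [|k IH]; first by rewrite mul0r addr0 mul1r expn0 expr1.
  rewrite expnSr exprM; set w := z ^+ (2 ^ k) in IH *.
  have -> : w ^+ 2 - 1 = (w - 1) * (2 + (w - 1)) by ring.
  have w_half : `|w - 1| <= 2^-1 := le_half _.
  have ge32 : 1 + 2^-1 <= `|2 + (w - 1)| :> C.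
    have := lerB_normD (2 : C) (w - 1); rewrite normr_nat; apply: le_trans.
    have -> : 1 + 2^-1 = 2 - 2^-1 :> C by field.
    by rewrite lerD2l lerN2.
  rewrite normrM; apply: le_trans (ler_pM _ _ IH ge32).
  - rewrite mulrAC ler_wpM2r // -natr1 -subr_ge0.
    have -> : (1 + k%:R / 2) * (1 + 2^-1) - (1 + (k%:R + 1) / 2) = k%:R / 4 :> C.
      by field.
    by rewrite divr_ge0 ?ler0n.
  - by rewrite mulr_ge0 // addr_ge0 // divr_ge0 ?ler0n.
  - by rewrite addr_ge0 // invr_ge0 ler0n.
have bounded k : k%:R * `|z - 1| <= 1 :> C.
  have := le_trans (grow k) (le_half _).
  rewrite -(ler_pM2l (ltr0n C 2)) mulfV ?pnatr_eq0 //.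
  apply: le_trans; rewrite -subr_ge0.
  have -> : 2 * ((1 + k%:R / 2) * `|z - 1|) - k%:R * `|z - 1| = 2 * `|z - 1| :> C.
    by field.
  by rewrite mulr_ge0.
(* The distance is turned into a real number so that the Archimedean property of [R] refutes
   [bounded]. *)
have [r zr] : exists r : R, `|z - 1| = (r%:C)%C by rewrite normc_def; eexists.
have r0 : 0 < r by rewrite -ltcR -zr normr_gt0 subr_eq0.
have := bounded (Num.truncn r^-1).+1.
rewrite zr -(rmorph_nat (real_complex R)) -rmorphM.
rewrite -(rmorph1 (real_complex R)) lecR.
rewrite -ler_pdivlMr // mul1r leNgt.
have /truncn_itv/andP[_ ->] // : 0 <= r^-1 by rewrite invr_ge0 ltW.
Qed.

End Circle.

(** With the indices cut into consecutive blocks of lengths [m 0], [m 1], and so on, [f n] is the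
    block containing [n]; composing a sequence with [f] repeats its [k]-th term [m k] times. *)
Lemma block_index (m : nat -> nat) (b := fun k => (\sum_(i < k) m i)%N) :
  (forall k, 0 < m k)%N ->
  exists f : nat -> nat, (forall n k, b k <= n -> k <= f n)%N /\
    (forall n k, b k <= n < b k.+1 -> f n = k)%N.
Proof.
move=> m0.
have bS k : b k.+1 = (b k + m k)%N by rewrite /b big_ord_recr.
have b0 : b 0%N = 0%N by rewrite /b big_ord0.
have bmono k l : (k <= l)%N -> (b k <= b l)%N.
  move=> /subnK <-; elim: (l - k)%N => [|j IH] //.
  by rewrite addSn bS (leq_trans IH) ?leq_addr.
have /choice[f fP] n : exists k, (b k <= n < b k.+1)%N.
  elim: n => [|n [k /andP[bkn nbk]]].
    by exists 0%N; rewrite bS b0 m0.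
  move: nbk; rewrite leq_eqVlt => /predU1P[nb|nb].
    exists k.+1.
    by rewrite nb leqnn [b k.+2]bS -[X in (X < _)%N]addn0 ltn_add2l m0.
  by exists k; rewrite nb (leq_trans bkn).
have fge n k : (b k <= n)%N -> (k <= f n)%N.
  move=> bn; rewrite leqNgt; apply/negP => fk.
  have /andP[_] := fP n; rewrite ltnNge => /negP; apply.
  exact: leq_trans (bmono _ _ fk) bn.
exists f; split=> // n k /andP[bn nb]; apply/eqP; rewrite eqn_leq fge // andbT.
rewrite leqNgt; apply/negP => kf; move: nb; rewrite ltnNge => /negP; apply.
by have /andP[+ _] := fP n; apply: leq_trans; exact: bmono.
Qed.

Section Characters.
Variables (R : realType) (X : topologicalZmodType).
Local Notation C := (R[i]^o).
Implicit Types (xi : X -> C) (a : X).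

Lemma dual_neq0 xi a : dual R X xi -> xi a != 0.
Proof. by case=> xi1 _ _; rewrite -normr_gt0 xi1. Qed.

Lemma dual0 xi : dual R X xi -> xi 0 = 1.
Proof.
move=> dxi; have [_ xiD _] := dxi; apply: (mulfI (dual_neq0 0 dxi)).
by rewrite -xiD addr0 mulr1.
Qed.

Lemma dualMn xi a n : dual R X xi -> xi (a *+ n) = xi a ^+ n.
Proof.
move=> dxi; elim: n => [|n IH]; first by rewrite mulr0n dual0.
by case: (dxi) => _ xiD _; rewrite mulrS xiD IH exprS.
Qed.

Lemma norm_dual_prod xi (x : nat -> X) n : dual R X xi ->
  `|\prod_(k < n) xi (x k)| = 1.
Proof. by case=> xi1 _ _; rewrite normr_prod big1 // => k _; exact: xi1. Qed.

(** Each [x k] is repeated until the power of [xi (x k)] is farther than 1/2 from 1. The partial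
    products before and after every block are then more than 1/2 apart. *)
Lemma null_seq_not_Gamma_abs xi (x : nat -> X) :
  dual R X xi -> c0 X x -> (forall k, xi (x k) != 1) -> ~ Gamma_abs R X xi.
Proof.
move=> dxi x0 xi_x [_ /= Gxi].
have /choice[m mP] k := circle_power_far (xi_x k).
have m0 k : (0 < m k)%N.
  rewrite lt0n; apply/eqP => mk; have := mP k.
  by rewrite mk expr0 subrr normr0 => /lt_gtF; rewrite invr_gt0 ltr0n.
have [f [fge fE]] := block_index m0.
pose b k := (\sum_(i < k) m i)%N.
have bS k : b k.+1 = (b k + m k)%N by rewrite /b big_ord_recr.
have b_ge k : (k <= b k)%N.
  elim: k => // k IH; rewrite bS -addn1; exact: leq_add.
have f_oo : f @ \oo --> \oo.
  move=> A [N _ NA]; exists (b N) => // n /= bn; apply: NA => /=.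
  exact: fge.
have [|l _ cvl] := Gxi (x \o f); first exact: (cvg_comp _ _ f_oo x0).
(* Two partial products within 1/4 of the limit are within 1/2 of each other. *)
have e0 : 0 < 4^-1 :> C by rewrite invr_gt0 ltr0n.
have /cvgrPdist_lt /(_ _ e0) [N _ hN] := cvl.
pose p n : C := \prod_(k < n) xi ((x \o f) k).
have pS : p (b N.+1) = p (b N) * xi (x N) ^+ m N.
  rewrite /p -!(big_mkord xpredT (fun k => xi ((x \o f) k))).
  rewrite (@big_cat_nat _ _ _ (b N)) //= ?bS ?leq_addr //; congr (_ * _).
  rewrite (eq_big_nat _ _ (F2 := fun=> xi (x N))); last first.
    by move=> i; rewrite -bS => /fE ->.
  by rewrite prodr_const_nat addKn.
have : `|xi (x N) ^+ m N - 1| <= 2^-1.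
  have -> : `|xi (x N) ^+ m N - 1| = `|(l - p (b N)) - (l - p (b N.+1))|.
    have -> : l - p (b N) - (l - p (b N.+1)) = p (b N) * (xi (x N) ^+ m N - 1).
      by rewrite pS; ring.
    by rewrite normrM norm_dual_prod // mul1r.
  apply: le_trans (ler_normB _ _) _.
  have -> : 2^-1 = 4^-1 + 4^-1 :> C by field.
  apply: lerD; apply/ltW/hN => /=; first exact: b_ge.
  by apply: leq_trans (b_ge _); exact: leqnSn.
by move=> /(lt_le_trans (mP N)); rewrite ltxx.
Qed.

(** A subgroup that is a neighborhood of 0 is clopen. *)
Lemma dual_ker_nbhs xi : connected [set: X] -> dual R X xi ->
  nbhs 0 [set a | xi a = 1] -> xi = cst 1.
Proof.
move=> cX dxi nK; have [_ xiD _] := dxi.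
set K := [set a | xi a = 1] in nK.
have xiK a t : K (t - a) -> xi t = xi a.
  by rewrite -{2}(subrK a t) xiD => ->; rewrite mul1r.
suff KT : K = [set: X] by apply/funext => a; have : K a by rewrite KT.
apply: cX.
- by exists 0; exact: dual0.
- exists K; last by rewrite setTI.
  rewrite openE => a Ka; have := nbhs_subr a nK.
  by apply: filterS => t /xiK; rewrite /K /= => ->.
- exists K; last by rewrite setTI.
  move=> a /(_ _ (nbhs_subr a nK))[t [Kt /xiK]].
  by rewrite /K /= => <-.
Qed.

Lemma null_seq_outside_kernel xi :
  hausdorff_space X -> locally_compact [set: X] -> dual R X xi ->
  ~ nbhs 0 [set a | xi a = 1] ->
  exists2 x : nat -> X, c0 X x & forall k, xi (x k) != 1.
Proof.
move=> hX lcX dxi nker; have [_ xiD cxi] := dxi.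
have [K nK [cK clK]] := compact_nbhs0 lcX.
(* By [circle_power_far], any subgroup contained in [U] lies in the kernel of [xi]. *)
pose U := K `&` [set a | `|1 - xi a| <= 2^-1].
have nU : nbhs 0 U.
  apply: filterI => //; have := cxi 0; rewrite /continuous_at dual0 //.
  have e0 : 0 < 2^-1 :> C by rewrite invr_gt0 ltr0n.
  by move=> /cvgrPdist_le /(_ _ e0).
have [V hV0 hV] := nbhs0_seq nU.
have cV k : closed (V k) by case: k => [|k]; [case: hV0 | case: (hV k)].
pose N := K `&` \bigcap_k V k.
have NV a : (forall k, V k a) -> N a.
  by move=> Va; split=> [|k _]; [case: (small_half_sub hV0 (Va _)) | exact: Va].
have sN : subgroup N.
  have [//|N0 NB] := @small_seq_bigcap_subgroup X V hV setT.
  split; first by apply: NV => k; case: N0 => _; exact.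
  move=> a b [_ Va] [_ Vb]; apply: NV => k.
  by have [//|//|_] := NB a b; exact.
have cN : compact N.
  by apply: compact_closedI => //; apply: closed_bigI => k _; exact: cV.
have NMn a n : N a -> N (a *+ n).
  move=> Na; elim: n => [|n IH]; first by rewrite mulr0n; case: sN.
  by rewrite mulrS; exact: subgroupD.
have Nker a : N a -> xi a = 1.
  move=> Na; apply: contrapT => /eqP /circle_power_far[m].
  have [_ /(_ 0 I) /(small_half_sub hV0)[_ /=]] := NMn a m Na.
  by rewrite distrC dualMn // => le2 /lt_le_trans /(_ le2); rewrite ltxx.
(* The kernel is not a neighborhood of 0, so it contains no [V k]. *)
have /choice[x xP] k : exists a, V k a /\ xi a != 1.
  apply: contrapT => no; apply: nker.
  apply: filterS (small_seq_nbhs hV k) => a Va.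
  by apply: contrapT => /eqP xia; apply: no; exists a.
have xN : null_mod N x.
  move=> O nO; have [j hj] := small_seq_thickening hV cV cK nO.
  exists j => // n /= jn; have [Vx _] := xP n.
  apply: hj; last exact: (small_seq_sub hV jn).
  by have [] := small_half_sub hV0 (small_seq_sub hV (leq0n n) Vx).
(* The correction adds elements of [N], on which [xi] is 1, so the values of [xi] stay the same. *)
have [y yx y0] := lift_null hX cN sN xN.
exists y => // k; rewrite -(subrK (x k) (y k)) xiD Nker // mul1r.
by case: (xP k).
Qed.

Lemma cst1_Gamma_abs : Gamma_abs R X (cst 1).
Proof.
split.
  split=> [x|x y|]; first by rewrite /circle /= normr1.
    by rewrite mulr1.
  exact: cst_continuous.
move=> x _; exists 1; first by rewrite /circle /= normr1.
rewrite (_ : (fun n => _) = cst 1); first exact: cvg_cst.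
by apply/funext => n; rewrite big1.
Qed.

Lemma connected_class_B :
  hausdorff_space X -> locally_compact [set: X] -> connected [set: X] ->
  class_B R X.
Proof.
move=> hX lcX cX; apply/seteqP; split=> [xi Gxi|_ ->]; last exact: cst1_Gamma_abs.
have dxi := Gxi.1.
have [|nker] := pselect (nbhs 0 [set a | xi a = 1]).
  exact: dual_ker_nbhs.
have [x x0 xi_x] := null_seq_outside_kernel hX lcX dxi nker.
by case: (null_seq_not_Gamma_abs dxi x0 xi_x).
Qed.

End Characters.

(** * Extension of characters *)

(** Only [z = 1] needs care: there [w] is a root of the sum of the powers of the variable below [d],
    whose value at 1 is [d], not 0. *)
Lemma root_neq1 (C : numClosedFieldType) (z : C) d : (1 < d)%N ->
  exists2 w, w ^+ d = z & w != 1.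
Proof.
move=> d1; have d0 : (0 < d)%N by apply: ltnW.
have [->|z1] := eqVneq z 1; last first.
  exists (d.-root z); first by rewrite rootCK.
  by apply: contra_neq z1 => w1; rewrite -(rootCK d0 z) w1 expr1n.
pose p : {poly C} := \poly_(i < d) 1.
have sp : size p = d by rewrite size_poly_eq ?oner_neq0.
have /closed_rootP[w /rootP] : size p != 1%N by rewrite sp gtn_eqF.
rewrite horner_poly; under eq_bigr do rewrite mul1r.
move=> w0; exists w.
  by apply/eqP; rewrite -subr_eq0 subrX1 w0 mulr0.
apply/eqP => w1; move: w0; rewrite w1; under eq_bigr do rewrite expr1n.
by move/eqP; rewrite sumr_const card_ord pnatr_eq0 gtn_eqF.
Qed.

Section PartialCharacters.
Variables (C : numClosedFieldType) (X : zmodType).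
Implicit Types (G H : set (X * C)) (a b : X) (z w : C).

(* [G] is the graph of a character of a subgroup of [X]. *)
Definition partial_char G := [/\ G (0, 1),
  forall a b z w, G (a, z) -> G (b, w) -> G (a - b, z / w),
  forall z, G (0, z) -> z = 1 & forall a z, G (a, z) -> `|z| = 1].

Lemma partial_char_inj G a z w :
  partial_char G -> G (a, z) -> G (a, w) -> z = w.
Proof.
move=> [_ GB G1 Gn] Gz Gw; have w0 : w != 0.
  by rewrite -normr_gt0 (Gn _ _ Gw) ltr01.
have := GB _ _ _ _ Gz Gw; rewrite subrr => /G1 zw.
by rewrite -(divfK w0 z) zw mul1r.
Qed.

Lemma partial_charN G a z : partial_char G -> G (a, z) -> G (- a, z^-1).
Proof. by move=> [G0 GB _ _] Gz; rewrite -sub0r -div1r; exact: GB. Qed.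

Lemma partial_charD G a b z w :
  partial_char G -> G (a, z) -> G (b, w) -> G (a + b, z * w).
Proof.
move=> pG Gz /(partial_charN pG) Gw; have [_ GB _ _] := pG.
by rewrite -[b]opprK -[w]invrK; exact: GB.
Qed.

Lemma partial_charMn G a z n : partial_char G -> G (a, z) -> G (a *+ n, z ^+ n).
Proof.
move=> pG Gz; elim: n => [|n IH]; first by case: pG.
by rewrite mulrS exprS; exact: partial_charD.
Qed.

(** The positive [n] with [b *+ n] in the domain are the multiples of the least one, [d], and
    [d > 1] since [b] is outside. So [w] only has to be a [d]-th root of the value at [b *+ d]. *)
Lemma partial_char_value G b : partial_char G -> (forall z, ~ G (b, z)) ->
  exists w, [/\ w != 1, `|w| = 1 & forall n z, G (b *+ n, z) -> w ^+ n = z].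
Proof.
move=> pG nb; have [G0 _ G1 Gn] := pG.
pose P n := `[< (0 < n)%N /\ exists z, G (b *+ n, z) >].
have [[n0 Pn0]|noP] := pselect (exists n, P n); last first.
  (* No positive multiple of [b] is in the domain, so any [w] on the circle other than 1 would
     do. *)
  exists (-1); split; [|by rewrite normrN1|].
    by rewrite eqNr oner_neq0.
  case=> [z /G1 -> //|n z Gz]; case: noP; exists n.+1; apply/asboolP.
  by split=> //; exists z.
case: (ex_minnP (ex_intro _ n0 Pn0)) => d /asboolP[d0 [z0 Gz0]] dmin.
have d1 : (1 < d)%N.
  rewrite ltn_neqAle d0 andbT; apply/eqP => d1; apply: (nb z0).
  by move: Gz0; rewrite -d1 mulr1n.
have [w wd w1] := root_neq1 z0 d1.
exists w; split=> //.
  have /eqP : `|w| ^+ d = 1 by rewrite -normrX wd (Gn _ _ Gz0).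
  by rewrite pexpr_eq1 // => /eqP.
move=> n z Gz; have r_lt : (n %% d < d)%N by rewrite ltn_mod.
have : G (b *+ (n %% d), z / z0 ^+ (n %/ d)).
  have := partial_charD pG Gz (partial_charN pG (partial_charMn (n %/ d) pG Gz0)).
  congr (G (_, _)).
  by rewrite {1}(divn_eq n d) mulrnDr mulnC mulrnA addrAC subrr add0r.
have [r0|r_gt0] := posnP (n %% d)%N; last first.
  move=> Gr; have /dmin : P (n %% d)%N.
    by apply/asboolP; split=> //; eexists; exact: Gr.
  by rewrite leqNgt r_lt.
rewrite r0 mulr0n => /G1 zz; rewrite {1}(divn_eq n d) r0 addn0 mulnC exprM wd.
have zn0 : z0 ^+ (n %/ d) != 0.
  by rewrite expf_neq0 // -normr_gt0 (Gn _ _ Gz0).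
by rewrite -(divfK zn0 z) zz mul1r.
Qed.

Lemma partial_char_step G b : partial_char G -> (forall z, ~ G (b, z)) ->
  exists G' w, [/\ partial_char G', G `<=` G', G' (b, w) & w != 1].
Proof.
move=> pG nb; have [w [w1 nw hw]] := partial_char_value pG nb.
have [G0 GB G1 Gn] := pG.
have w0 : w != 0 by rewrite -normr_gt0 nw ltr01.
have hwz (n : int) z : G (b *~ n, z) -> w ^ n = z.
  case: n => n; first exact: hw.
  rewrite NegzE mulrNz => /(partial_charN pG); rewrite opprK => /hw wz.
  by rewrite -exprnN wz invrK.
have nwz (n : int) : `|w ^ n| = 1.
  by case: n => n; rewrite ?NegzE -?exprnN ?normfV normrX nw expr1n ?invr1.
(* This extends the character to the domain plus the multiples of [b], with value [w] at [b]; [hwz]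
   gives uniqueness of the value at 0. *)
pose G' : set (X * C) := [set p | exists n : int, G (p.1 - b *~ n, p.2 / w ^ n)].
have GG' : G `<=` G' by move=> [a z] Gz; exists 0; rewrite /= subr0 divr1.
exists G', w; split=> //; last by exists 1; rewrite /= subrr divff.
split.
- exact: GG'.
- move=> a c z u [n /= Gn1] [m /= Gm]; exists (n - m) => /=.
  have := GB _ _ _ _ Gn1 Gm; congr (G (_, _)).
    rewrite mulrzBr !opprB -!addrA [_ + (_ - c)]addrCA [- c + _]addrCA.
    by rewrite [- c - _]addrC.
  by rewrite expfzDr // -invr_expz !invfM !invrK mulrACA.
- move=> z [n /=]; rewrite sub0r -mulrNz => /hwz wz.
  have wn0 : w ^ n != 0 by rewrite expfz_neq0.
  by rewrite -(divfK wn0 z) -wz -expfzDr // addNr.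
- by move=> a z [n /= /Gn]; rewrite normrM normfV nwz invr1 mulr1.
Qed.

Lemma partial_char_extend G : partial_char G -> exists xi : X -> C,
  [/\ forall a, `|xi a| = 1, forall a b, xi (a + b) = xi a * xi b
    & forall a z, G (a, z) -> xi a = z].
Proof.
move=> pG.
pose P : set (set (X * C)) :=
  [set H | H = set0 \/ (partial_char H /\ G `<=` H)].
have [F FP totF|H [PH maxH]] := @Zorn_bigcup _ P.
  have [[H0 FH0 [p0 H0p0]]|no] := pselect (exists2 H, F H & H !=set0); last first.
    left; apply/seteqP; split=> // p [H FH Hp]; apply: no.
    by exists H => //; exists p.
  have good H p : F H -> H p -> partial_char H /\ G `<=` H.
    by move=> FH Hp; case: (FP H FH) => // H0'; move: Hp; rewrite H0'.
  have [pH0 GH0] := good _ _ FH0 H0p0.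
  right; split; last by move=> p /GH0; exists H0.
  split.
  - by exists H0 => //; case: pH0.
  - move=> a b z w [H FH Hz] [H' FH' H'w].
    have [HH'|H'H] := totF _ _ FH FH'.
      exists H' => //; have [[_ + _ _] _] := good _ _ FH' H'w; apply=> //.
      exact: HH'.
    exists H => //; have [[_ + _ _] _] := good _ _ FH Hz; apply=> //.
    exact: H'H.
  - by move=> z [H FH Hz]; have [[_ _ H1 _] _] := good _ _ FH Hz; exact: H1.
  - by move=> a z [H FH Hz]; have [[_ _ _ Hn] _] := good _ _ FH Hz; exact: Hn Hz.
have [pH GH] : partial_char H /\ G `<=` H.
  case: PH => // H0; exfalso; apply: (maxH G); last by right; split.
  by rewrite H0; split=> // G0; have [G01 _ _ _] := pG; exact: (G0 _ G01).
have /choice[xi xiP] a : exists z, H (a, z).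
  apply: contrapT => no.
  have [|H' [w [pH' HH' H'w _]]] := @partial_char_step H a pH.
    by move=> z Hz; apply: no; exists z.
  apply: (maxH H'); last by right; split=> //; exact: subset_trans GH HH'.
  by split=> // H'H; apply: no; exists w; exact: H'H.
exists xi; split.
- by move=> a; have [_ _ _] := pH; apply; exact: xiP.
- move=> a b; apply: (partial_char_inj pH (xiP _)); exact: partial_charD.
- by move=> a z /GH; exact: partial_char_inj.
Qed.

(** The trivial character of [N] is first extended to [a] with a value other than 1, and only then
    to the whole group. *)
Lemma subgroup_character (N : set X) a : subgroup N -> ~ N a ->
  exists xi : X -> C, [/\ forall b, `|xi b| = 1,
    forall b c, xi (b + c) = xi b * xi c,
    forall b, N b -> xi b = 1 & xi a != 1].
Proof.
move=> [N0 NB] Na; pose G : set (X * C) := [set p | N p.1 /\ p.2 = 1].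
have pG : partial_char G.
  split=> //=.
  - move=> b c z w [/= Nb ->] [/= Nc ->].
    by split; [exact: NB | rewrite /= divr1].
  - by move=> z [].
  - by move=> b z [/= _ ->]; rewrite normr1.
have [|G' [w [pG' GG' G'w w1]]] := @partial_char_step G a pG.
  by move=> z [].
have [xi [xi1 xiD xiG]] := partial_char_extend pG'.
exists xi; split=> // [b Nb|]; first by apply: xiG; exact: GG'.
by rewrite (xiG _ _ G'w).
Qed.

End PartialCharacters.

Lemma class_B_locally_generated (R : realType) (X : topologicalZmodType) :
  class_B R X -> locally_generated X.
Proof.
move=> BX V nV; apply/seteqP; split=> // a _; apply: contrapT => Va.
have VH : V `<=` generated_subgroup V by exact: sub_gen_smallest.
have sH : subgroup (generated_subgroup V).
  split=> [A [[A0 _] _]|b c Hb Hc A [sA VA]]; first by rewrite inE in A0.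
  have [_ AB] := sA; have := AB b c; rewrite !inE; apply.
    exact: Hb.
  exact: Hc.
have [xi [xi1 xiD xiH xia]] := @subgroup_character (R[i]^o) X _ _ sH Va.
suff : Gamma_abs R X xi by rewrite BX => xiE; move: xia; rewrite xiE eqxx.
split.
  (* Being trivial on [V], [xi] is constant on each translate of [V], hence continuous. *)
  split=> // b; apply: (@cvg_near_cst _ _ (xi b)).
  have := nbhs_subr b nV; apply: filterS => t /VH /xiH xit.
  by rewrite -(subrK b t) xiD xit mul1r.
(* From [N] on the terms lie in [V], so all further factors are 1. *)
move=> x x0; have [N _ hN] := x0 _ nV.
exists (\prod_(k < N) xi (x k)); first by rewrite /circle /= normr_prod big1.
apply: cvg_near_cst; exists N => // n /= Nn.
rewrite -!(big_mkord xpredT (fun k => xi (x k))) (@big_cat_nat _ _ _ N) //=.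
rewrite [X in _ * X]big_nat [X in _ * X]big1 ?mulr1 // => k /andP[Nk _].
by apply: xiH; apply: VH; exact: hN.
Qed.

Theorem theorem6p15 (R : realType) (X : topologicalZmodType)
    (X_hausdorff : hausdorff_space X)
    (X_locally_compact : locally_compact [set: X]) :
  [<-> class_B R X; locally_generated X; connected [set: X]].
Proof.
tfae.
- exact: class_B_locally_generated.
- exact: locally_generated_connected.
- exact: connected_class_B.
Qed.
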